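(* Every bivariate copula $C$ satisfies \[ |\nu(C)-\eta(C)|\le\frac{27}{128},\qquad\text{equivalently}\qquad |\nu(C)-\nu(C^\top)|\le\frac{27}{64}. \] Both constants are sharp: the maximum $\frac{27}{128}$ of $\nu-\eta$ over all copulas is attained only by $A_{3/4}$, at which $(\eta,\nu)=(-\frac{5}{32},\frac{7}{128})$, and the minimum $-\frac{27}{128}$ is attained only by $A_{3/4}^\top$.
   Context: A (bivariate) copula is (the restriction to $[0,1]^2$ of) a distribution function of a probability measure on $[0,1]^2$ with uniform marginals. For a copula $C$, its transpose is $C^\top(u,v)=C(v,u)$, Blest's rank correlation is $\nu(C)=24\int_0^1\int_0^1(1-u)\,C(u,v)\,du\,dv-2$, and the symmetrized Blest coefficient is $\eta(C)=\frac{\nu(C)+\nu(C^\top)}{2}$. For $w\in[0,1]$, $A_w$ is the joint distribution function of $(1-X,\,1-T_w(X))$, where $X$ is uniformly distributed on $[0,1]$ and $T_w(x)=1-x$ for $0\le x\le 1-w$, $T_w(x)=x+w-1$ for $1-w<x\le1$. *)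

(* Defs.v *)
From HB Require Import structures.
From mathcomp Require Import all_boot all_order all_algebra.
From mathcomp Require Import all_classical all_reals all_analysis.
Set Implicit Arguments.
Unset Strict Implicit.
Unset Printing Implicit Defensive.
Import Order.TTheory GRing.Theory Num.Theory.
Import numFieldNormedType.Exports.
Local Open Scope classical_set_scope.
Local Open Scope ring_scope.

Definition joint_cdf d (T : measurableType d) (R : realType)
    (P : probability T R) (X Y : T -> R) (u v : R) : R :=
  fine (P [set t | X t <= u /\ Y t <= v]).

Definition unif01 (R : realType) : probability (measurableTypeR R) R :=
  uniform_prob (@ltr01 R).

(* A bivariate copula is represented by a function on R^2 of which only the
   restriction to [0,1]^2 is relevant; two representatives denote the same
   copula when they satisfy [eq_on_square]. *)
Definition eq_on_square (R : realType) (C D : R -> R -> R) : Prop :=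
  forall u v : R, 0 <= u <= 1 -> 0 <= v <= 1 -> C u v = D u v.

Definition is_copula (R : realType) (C : R -> R -> R) : Prop :=
  exists P : probability (measurableTypeR R * measurableTypeR R)%type R,
    [/\ P (`[0, 1] `*` `[0, 1]) = 1%E,
        forall A : set (measurableTypeR R),
          measurable A -> pushforward P fst A = unif01 R A,
        forall A : set (measurableTypeR R),
          measurable A -> pushforward P snd A = unif01 R A
      & eq_on_square C (joint_cdf P fst snd)].

Definition transpose (R : realType) (C : R -> R -> R) : R -> R -> R :=
  fun u v => C v u.

Definition blest (R : realType) (C : R -> R -> R) : R :=
  24 * (\int[lebesgue_measure]_(v in `[0, 1])
          \int[lebesgue_measure]_(u in `[0, 1]) ((1 - u) * C u v)) - 2.

Definition sym_blest (R : realType) (C : R -> R -> R) : R :=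
  (blest C + blest (transpose C)) / 2.

Definition Tmap (R : realType) (w x : R) : R :=
  if x <= 1 - w then 1 - x else x + w - 1.

(* The uniform variable X is realised as the identity on (R, unif01). *)
Definition Acopula (R : realType) (w : R) : R -> R -> R :=
  joint_cdf (unif01 R) (fun x : R => 1 - x) (fun x : R => 1 - Tmap w x).

(* Main.v *)
(* Let (U, V) have distribution function C and put X = 1 - U, Y = 1 - V.
   Tonelli gives nu(C) = 12 E[X^2 Y] - 2, hence
   nu(C) - nu(C^T) = 12 E[X Y (X - Y)]: maximizing it over all copulas is an
   optimal transport problem between two uniform laws, which is solved by
   duality.  Integrating the partial derivatives of x y (x - y) along the graph
   of T_(3/4) gives potentials with potx x + poty y >= x y (x - y) on the unit
   square.  So E[potx X + poty Y], which does not depend on C, is an upper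
   bound.  Equality in the pointwise inequality holds only on the graph, up to
   one point with abscissa 1/4, so the bound is attained by A_(3/4), and a
   maximizer satisfies Y = T_(3/4)(X) almost surely. *)

Require Import Defs.
From HB Require Import structures.
From mathcomp Require Import all_boot all_order all_algebra.
From mathcomp Require Import all_classical all_reals all_analysis.
From mathcomp Require Import measurable_realfun.
From mathcomp Require Import ring lra.
Set Implicit Arguments.
Unset Strict Implicit.
Unset Printing Implicit Defensive.
Import Order.TTheory GRing.Theory Num.Theory.
Import numFieldNormedType.Exports.
Local Open Scope classical_set_scope.
Local Open Scope ring_scope.

(** * Dual potentials for the cost and the equality case on the unit square *)

Section duality.
Variable R : realType.
Implicit Types x y : R.

Definition cost x y := x * y * (x - y).

(** The branches integrate [2 * x * y - y ^+ 2] in [x] along the graph of [Tmap (3 / 4)], with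
    [y = 1 - x] and then [y = x - 1 / 4]. The constants make both branches vanish at [1 / 4]. *)
Definition potx x :=
  if x <= 1 / 4 then 9 / 64 - x * (1 - x) ^+ 2
  else x ^+ 3 / 3 - x / 16 + 1 / 96.

(** The branches integrate [x ^+ 2 - 2 * x * y] in [y], with [x = y + 1 / 4] and then [x = 1 - y].
    The constants give [poty 0 = 0] and continuity at [3 / 4], so equality with the cost holds at
    both ends of the jump of the graph. *)
Definition poty y :=
  if y <= 3 / 4 then y / 16 - y ^+ 3 / 3 else y * (1 - y) ^+ 2 - 9 / 64.

(* The polynomial in the conclusion is the surplus of the potentials over the
   cost in the two off-graph quadrants, with [t] and [p] the distances to their
   sides. *)
Lemma surplus_ge (z p t : R) : 0 <= p <= 1 -> 0 <= t ->
  t ^+ 2 / 2 <=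
    z ^+ 2 * p / 3 + p * (1 - p) * t + (1 + 2 * p) * t ^+ 2 / 2 + t ^+ 3.
Proof.
move=> /andP[p0 p1] t0; have q0 : 0 <= 1 - p by lra.
rewrite -subr_ge0.
have -> : z ^+ 2 * p / 3 + p * (1 - p) * t + (1 + 2 * p) * t ^+ 2 / 2 +
  t ^+ 3 - t ^+ 2 / 2 = z ^+ 2 * p / 3 + p * (1 - p) * t + p * t ^+ 2 + t ^+ 3.
  by field.
apply: addr_ge0; last exact: exprn_ge0.
apply: addr_ge0; last by rewrite mulr_ge0// exprn_ge0.
apply: addr_ge0; last by rewrite !mulr_ge0.
by rewrite divr_ge0// mulr_ge0// sqr_ge0.
Qed.

(** The quadratic margin is what later excludes equality in this quadrant away from [x = 1 / 4]. The
    reflection of [(x, y)] to [(1 - y, 1 - x)] preserves cost and surplus and exchanges this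
    quadrant with the top right one, so [surplus_ge] serves both. *)
Lemma pot_bottomleft x y : 0 <= x <= 1 / 4 -> 0 <= y <= 3 / 4 ->
  cost x y + (1 / 4 - x) ^+ 2 / 2 <= potx x + poty y.
Proof.
move=> /andP[x0 x4] /andP[y0 y4].
rewrite /cost /potx /poty x4 y4 -lerBrDl.
apply: le_trans (@surplus_ge y (3 / 4 - y) (1 / 4 - x) _ _) _; lra.
Qed.

Lemma pot_topright x y : 1 / 4 < x <= 1 -> 3 / 4 < y <= 1 ->
  cost x y + (y - 3 / 4) ^+ 2 / 2 <= potx x + poty y.
Proof.
move=> /andP[x4 x1] /andP[y4 y1].
rewrite /cost /potx /poty (lt_geF x4) (lt_geF y4) -lerBrDl.
apply: le_trans (@surplus_ge (1 - x) (x - 1 / 4) (y - 3 / 4) _ _) _; lra.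
Qed.

(** The decreasing branch of the graph lies here, apart from its corner, and tangency gives the
    squared equation of the branch; the cofactor exceeds [1 / 2]. *)
Lemma pot_topleft x y : x <= 1 / 4 -> 3 / 4 < y ->
  potx x + poty y = cost x y + (y - x) * (1 - x - y) ^+ 2.
Proof. by move=> x4 y4; rewrite /cost /potx /poty x4 (lt_geF y4); field. Qed.

(** Likewise for the increasing branch [y = x - 1 / 4]; the cofactor is positive because
    [x - y > - 1 / 2]. *)
Lemma pot_bottomright x y : 1 / 4 < x -> y <= 3 / 4 ->
  potx x + poty y =
  cost x y + (x - y - 1 / 4) ^+ 2 * ((x - y + 1 / 2) / 3).
Proof. by move=> x4 y4; rewrite /cost /potx /poty y4 (lt_geF x4); field. Qed.

Lemma cost_le_pot x y : 0 <= x <= 1 -> 0 <= y <= 1 ->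
  cost x y <= potx x + poty y.
Proof.
move=> x01 y01.
have [x4|x4] := leP x (1 / 4); have [y4|y4] := leP y (3 / 4).
- apply: le_trans (pot_bottomleft _ _); try lra.
  by rewrite lerDl divr_ge0// sqr_ge0.
- by rewrite pot_topleft// lerDl mulr_ge0 ?sqr_ge0//; lra.
- by rewrite pot_bottomright// lerDl mulr_ge0 ?sqr_ge0//; lra.
- apply: le_trans (pot_topright _ _); try lra.
  by rewrite lerDl divr_ge0// sqr_ge0.
Qed.

(* At [x = 1/4] equality also holds for [y = 0], the limit of the second branch
   of [Tmap]. *)
Lemma cost_eq_pot x y : 0 <= x <= 1 -> 0 <= y <= 1 -> x != 1 / 4 ->
  potx x + poty y = cost x y -> y = Tmap (3 / 4) x.
Proof.
move=> x01 y01 xN4; rewrite /Tmap (_ : 1 - 3 / 4 = 1 / 4); last by field.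
have addI0 (a b : R) : a + b = a -> b = 0 by lra.
have [x4|x4] := leP x (1 / 4); have [y4|y4] := leP y (3 / 4).
- move=> e; have := @pot_bottomleft x y; rewrite e.
  have : 0 < (1 / 4 - x) ^+ 2 / 2.
    by rewrite divr_gt0// exprn_even_gt0//= subr_eq0 eq_sym.
  lra.
- rewrite pot_topleft// => /addI0/eqP; rewrite mulf_eq0 sqrf_eq0.
  by case/orP => /eqP; lra.
- rewrite pot_bottomright// => /addI0/eqP; rewrite mulf_eq0 sqrf_eq0.
  by case/orP => /eqP; lra.
- move=> e; have := @pot_topright x y; rewrite e.
  have : 0 < (y - 3 / 4) ^+ 2 / 2.
    by rewrite divr_gt0// exprn_even_gt0//= subr_eq0; apply/eqP; lra.
  lra.
Qed.

Lemma cost_Tmap x : 0 <= x <= 1 ->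
  cost x (Tmap (3 / 4) x) = potx x + poty (Tmap (3 / 4) x).
Proof.
move=> x01; rewrite /Tmap (_ : 1 - 3 / 4 = 1 / 4); last by field.
case: ifPn; rewrite -?ltNge => x4.
- have [x4'|x4'] := leP (1 - x) (3 / 4); last first.
    by rewrite pot_topleft// /cost; field.
  (* Only the corner [(1 / 4, 3 / 4)] of the graph falls in the bottom left quadrant. *)
  have -> : x = 1 / 4 by lra.
  by rewrite /potx /poty /cost !ifT; [field|lra..].
- by rewrite pot_bottomright//; [rewrite /cost; field|lra].
Qed.

Lemma Tmap01 x : 0 <= x <= 1 -> 0 <= Tmap (3 / 4) x <= 1.
Proof. by move=> x01; rewrite /Tmap; case: ifPn; lra. Qed.

End duality.

(** * Integrals of polynomials over tails of the unit interval *)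

Section polynomial_integrals.
Variable R : realType.
Local Notation mu := (@lebesgue_measure R).

Lemma integral_deriv_poly (p : {poly R}) (a b : R) : a <= b ->
  (\int[mu]_(x in `[a, b]) (p^`().[x])%:E = (p.[b] - p.[a])%:E)%E.
Proof.
rewrite le_eqVlt => /predU1P[->|ab].
  by rewrite set_itv1 integral_set1 subrr.
rewrite (@continuous_FTC2 _ _ (horner p))//.
- by apply: continuous_subspaceT => x; exact: continuous_horner.
- split; first by move=> x _; exact: derivable_horner.
  + by apply: cvg_at_right_filter; exact: continuous_horner.
  + by apply: cvg_at_left_filter; exact: continuous_horner.
- by move=> x _; rewrite derivE.
Qed.

(* Truncating the variables to [0, 1] makes the integral formulas below hold at
   every point, and not only almost surely. *)
Definition clip (s : R) : R := Num.max 0 (Num.min 1 s).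

Lemma clip01 s : 0 <= clip s <= 1.
Proof. by rewrite /clip le_max lexx/= ge_max ler01 ge_min lexx. Qed.

Lemma clip_id s : 0 <= s <= 1 -> clip s = s.
Proof. by move=> /andP[s0 s1]; rewrite /clip (min_idPr s1) (max_idPr s0). Qed.

Lemma integral_deriv_poly_tail (p : {poly R}) (s : R) :
  (\int[mu]_(u in `[0%R, 1%R]) (p^`().[u] * (s <= u)%R%:R)%:E
   = (p.[1] - p.[clip s])%:E)%E.
Proof.
rewrite -integral_deriv_poly; last by have /andP[] := clip01 s.
(* For [s > 1] the indicator vanishes on the unit interval and [[clip s, 1]] is a single point, so
   both sides are 0. *)
have [s1|s1] := leP s 1; last first.
  rewrite /clip (min_idPl (ltW s1)) (max_idPr ler01) set_itv1 integral_set1.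
  apply: integral0_eq => u/=; rewrite in_itv/= => /andP[_ u1].
  by rewrite leNgt (le_lt_trans u1 s1) mulr0.
have -> : `[clip s, 1%R]%classic = `[0%R, 1%R] `&` [set u : R | s <= u].
  apply/seteqP; split => u/=; rewrite /clip !in_itv/= (min_idPr s1) ge_max.
    by move=> /andP[/andP[-> ->] ->].
  by move=> [/andP[-> ->] ->].
rewrite integral_mkcondr; apply: eq_integral => u _; rewrite patchE/=.
case: ifPn => [/set_mem/= ->|]; first by rewrite mulr1.
by rewrite notin_setE/= => /negP/negbTE ->; rewrite mulr0.
Qed.

End polynomial_integrals.

Lemma measurable_ler_natr d (T : measurableType d) (R : realType) (D : set T)
    (f g : T -> R) :
  measurable_fun D f -> measurable_fun D g ->
  measurable_fun D (fun x => (f x <= g x)%R%:R : R).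
Proof.
move=> mf mg.
rewrite (_ : (fun x => _) = (fun x => if f x <= g x then 1 else 0 : R)).
  by move=> mD; move: (mD); apply: measurable_fun_if => //;
    exact: measurable_fun_ler.
by apply/funext => x; case: ifP.
Qed.

(** * Blest's coefficient as an expectation *)

Section blest_expectation.
Context d (T : measurableType d) (R : realType) (P : probability T R).
Local Notation mu := (@lebesgue_measure R).
Implicit Types X Y : T -> R.

Lemma bounded_integrable (f : T -> R) (M : R) :
  measurable_fun setT f -> (forall t, `|f t| <= M) ->
  P.-integrable setT (EFin \o f).
Proof.
move=> mf fM; apply: measurable_bounded_integrable => //.
  exact: (le_lt_trans (probability_le1 P measurableT) (ltry 1)).
exists M; split; first exact: num_real.
by move=> N MN t _ /=; rewrite (le_trans (fM t))// ltW.
Qed.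

Lemma measurable_clip : measurable_fun setT (@clip R).
Proof.
apply: measurable_maxr; first exact: measurable_cst.
by apply: measurable_minr => //; exact: measurable_cst.
Qed.

Lemma tonelli_tail (p : {poly R}) (X f : T -> R) :
  measurable_fun setT X -> measurable_fun setT f ->
  (forall t, 0 <= f t) -> (forall u : R, 0 <= u <= 1 -> 0 <= p^`().[u]) ->
  (\int[mu]_(u in `[0%R, 1%R])
      ((p^`().[u])%:E * \int[P]_t ((X t <= u)%R%:R * f t)%:E)
   = \int[P]_t (f t * (p.[1] - p.[clip (X t)]))%:E)%E.
Proof.
move=> mX mf f0 p0.
have mp : measurable_fun setT (horner p^`()).
  by apply: continuous_measurable_fun; exact: continuous_horner.
pose h (z : R * T) : \bar R :=
  (\1_(`[0, 1]%classic : set R) z.1 * p^`().[z.1] *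
   (X z.2 <= z.1)%R%:R * f z.2)%:E.
have h0 z : (0 <= h z)%E.
  rewrite lee_fin /h indicE; case: (boolP (_ \in _)) => [|_]; last first.
    by rewrite !mul0r.
  by rewrite inE/= in_itv/= => z01; rewrite mul1r !mulr_ge0// p0.
have mh : measurable_fun setT h.
  apply/measurable_EFinP; apply: measurable_funM; last first.
    exact: measurableT_comp.
  apply: measurable_funM; first apply: measurable_funM.
  - by apply: measurableT_comp => //; exact: measurable_indic.
  - exact: measurableT_comp mp measurable_fst.
  - by apply: measurable_ler_natr => //; exact: measurableT_comp.
have -> : (\int[mu]_(u in `[0%R, 1%R])
      ((p^`().[u])%:E * \int[P]_t ((X t <= u)%R%:R * f t)%:E) =
   \int[mu]_u \int[P]_t h (u, t))%E.
  rewrite integral_mkcond; apply: eq_integral => u _; rewrite patchE/=.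
  rewrite /h/= indicE; case: ifPn => [|_].
    rewrite inE/= in_itv/= => u01; rewrite -ge0_integralZl//.
    + by apply: eq_integral => t _; rewrite mul1r -EFinM mulrA.
    + apply/measurable_EFinP/measurable_funM => //.
      by apply: measurable_ler_natr => //; exact: measurable_cst.
    + by move=> t _; rewrite lee_fin mulr_ge0.
    + by rewrite lee_fin p0.
  by rewrite integral0_eq// => t _; rewrite !mul0r.
rewrite (@fubini_tonelli _ _ _ _ _ mu P h)//; apply: eq_integral => t _.
rewrite EFinM -integral_deriv_poly_tail -ge0_integralZl//.
- rewrite [RHS]integral_mkcond; apply: eq_integral => u _; rewrite patchE/=.
  rewrite /h/= indicE; case: ifPn => [|_]; last by rewrite !mul0r.
  by rewrite mul1r -EFinM mulrC.
- apply/measurable_EFinP/measurable_funM.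
    exact: measurable_funTS.
  by apply: measurable_ler_natr => //; exact: measurable_cst.
- move=> u/=; rewrite in_itv/= => u01; rewrite lee_fin mulr_ge0//; exact: p0.
- by rewrite lee_fin.
Qed.

Lemma blest_joint_cdf X Y :
  measurable_fun setT X -> measurable_fun setT Y ->
  blest (joint_cdf P X Y) =
  12 * \int[P]_t ((1 - clip (X t)) ^+ 2 * (1 - clip (Y t))) - 2.
Proof.
(* [K] is an antiderivative of the weight [1 - u]; its increment up to 1 produces the square in the
   result. *)
move=> mX mY; pose K : {poly R} := 'X - (1 / 2)%:P * 'X^2.
have K'E u : K^`().[u] = 1 - u.
  by rewrite /K !poly.derivE !hornerE; field.
have KE u : K.[1] - K.[u] = (1 - u) ^+ 2 / 2.
  by rewrite /K !hornerE/=; field.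
pose qX t := (1 - clip (X t)) ^+ 2 / 2.
pose iY v t : R := (Y t <= v)%R%:R.
have mclip (Z : T -> R) : measurable_fun setT Z ->
    measurable_fun setT (fun t => 1 - clip (Z t)).
  move=> mZ; apply: measurable_funB; first exact: measurable_cst.
  exact: measurableT_comp measurable_clip mZ.
have mqX : measurable_fun setT qX.
  apply: measurable_funM; last exact: measurable_cst.
  exact/measurable_funX/mclip.
have miY v : measurable_fun setT (iY v).
  by apply: measurable_ler_natr => //; exact: measurable_cst.
have qX01 t : 0 <= qX t <= 1.
  have /andP[c0 c1] := clip01 (X t); rewrite /qX; nra.
have iY01 v t : 0 <= iY v t <= 1.
  by rewrite /iY; case: (Y t <= v); rewrite lexx ler01.
(* Finiteness ensures that [fine] loses nothing when the iterated real integral is read in the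
   extended reals. *)
have fin (f g : T -> R) : measurable_fun setT f -> measurable_fun setT g ->
    (forall t, 0 <= f t <= 1) -> (forall t, 0 <= g t <= 1) ->
    (\int[P]_t (f t * g t)%:E)%E \is a fin_num.
  move=> mf mg f01 g01; apply: integrable_fin_num => //.
  apply: (@bounded_integrable _ 1) => [|t]; first exact: measurable_funM.
  move: (f01 t) (g01 t) => /andP[f0 f1] /andP[g0 g1].
  by rewrite ger0_norm ?mulr_ge0// mulr_ile1.
have inner v :
    \int[mu]_(u in `[0, 1]) ((1 - u) * joint_cdf P X Y u v) =
    fine (\int[P]_t (iY v t * qX t)%:E)%E.
  rewrite /Rintegral; congr fine.
  under [RHS]eq_integral do rewrite /qX -KE.
  rewrite -tonelli_tail//; last first.
    by move=> u /andP[_ u1]; rewrite K'E subr_ge0.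
  apply: eq_integral => u _; rewrite K'E EFinM; congr (_ * _)%E.
  have mS : measurable [set t | X t <= u /\ Y t <= v].
    rewrite (_ : [set t | _] = (setT `&` [set t | X t <= cst u t]) `&`
      (setT `&` [set t | Y t <= cst v t])); last by rewrite !setTI.
    by apply: measurableI; apply: measurable_fun_le.
  rewrite /joint_cdf fineK ?fin_num_measure// -[X in P X]setIT.
  rewrite -integral_indic//; apply: eq_integral => t _.
  rewrite indicE /iY; congr (_%:E).
  case: (boolP (t \in _)) => [/set_mem[/= -> ->]|]; first by rewrite mulr1.
  rewrite notin_setE/= => /not_andP[] /negP/negbTE ->; first by rewrite mul0r.
  by rewrite mulr0.
rewrite /blest.
under eq_Rintegral do rewrite inner.
rewrite {1}/Rintegral.
(* The variable [v] carries weight 1, so the second use of [tonelli_tail] takes the polynomial ['X],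
   with [qX] as the remaining factor. *)
have L'E v : ('X : {poly R})^`().[v] = 1 by rewrite !poly.derivE !hornerE.
have -> : (\int[mu]_(v in `[0%R, 1%R])
    (fine (\int[P]_t (iY v t * qX t)%:E))%:E =
    \int[P]_t (qX t * (1 - clip (Y t)))%:E)%E.
  have -> : (\int[P]_t (qX t * (1 - clip (Y t)))%:E =
      \int[P]_t (qX t *
        (('X : {poly R}).[1] - ('X : {poly R}).[clip (Y t)]))%:E)%E.
    by apply: eq_integral => t _; rewrite !hornerX.
  rewrite -tonelli_tail//; last 2 first.
  - by move=> t; have /andP[] := qX01 t.
  - by move=> u _; rewrite L'E.
  by apply: eq_integral => v _; rewrite L'E mul1e fineK// fin.
rewrite -[fine _]/(\int[P]_t (qX t * (1 - clip (Y t)))).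
have -> : \int[P]_t ((1 - clip (X t)) ^+ 2 * (1 - clip (Y t))) =
    \int[P]_t (2 * (qX t * (1 - clip (Y t)))).
  by apply: eq_Rintegral => t _; rewrite /qX; field.
rewrite RintegralZl//; first by field.
apply: (@bounded_integrable _ 1) => [|t].
  by apply: measurable_funM => //; exact: mclip.
have /andP[c0 c1] := clip01 (Y t); have /andP[q0 q1] := qX01 t.
have c0' : 0 <= 1 - clip (Y t) by lra.
have c1' : 1 - clip (Y t) <= 1 by lra.
by rewrite ger0_norm; [exact: mulr_ile1|exact: mulr_ge0].
Qed.

End blest_expectation.

(** * Uniform laws and measure-preserving maps of the unit interval *)

Section uniform_law.
Variable R : realType.
Local Notation mu := (@lebesgue_measure R).
Local Notation RT := (measurableTypeR R).

Lemma unif01E (A : set RT) : measurable A ->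
  unif01 R A = mu (A `&` `[0, 1]%classic).
Proof.
move=> mA; rewrite /unif01 /= /uniform_prob integral_uniform_pdf.
rewrite (eq_integral (cst 1%E)); last first.
  move=> x /set_mem[_ /=]; rewrite in_itv/= => x01.
  by rewrite /uniform_pdf x01 subr0 invr1.
by rewrite integral_cst ?mul1e//; exact: measurableI.
Qed.

(** [distribution] expects a bundled measurable function; the bundle is built here from a separate
    proof of measurability. *)
Definition law d d' (T : measurableType d) (T' : measurableType d')
    (P : probability T R) (X : T -> T') (mX : measurable_fun setT X) :
    probability T' R :=
  distribution P (MeasurableFun.Pack
    (MeasurableFun.Class (isMeasurableFun.Build _ _ _ _ _ mX))).

Definition uniform_law d (T : measurableType d) (P : probability T R)
    (X : T -> R) :=
  forall A : set RT, measurable A -> P (X @^-1` A) = unif01 R A.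

(** Open left rays are stable under intersection and generate the Borel sets, so they determine a
    probability measure. *)
Lemma lt_uniform_law d (T : measurableType d) (P : probability T R)
    (X : T -> R) : measurable_fun setT X ->
  (forall r : R, P (X @^-1` `]-oo, r[%classic) = unif01 R `]-oo, r[%classic) ->
  uniform_law P X.
Proof.
move=> mX Xlt A mA; rewrite -[LHS]/(@law _ _ T RT P X mX A).
apply: (@measure_unique _ R RT (@RGenInftyO.G R)
  (fun n : nat => `]-oo, n%:R : R[%classic) _ _ _ _
  (@law _ _ T RT P X mX) (unif01 R)) => //.
- exact: RGenInftyO.measurableE.
- move=> _ _ [x ->] [y ->]; exists (Num.min x y).
  by apply/seteqP; split => z; rewrite /= !in_itv/= lt_min => /andP.
- by move=> n; exists n%:R.
- apply/seteqP; split => // x _; exists (Num.truncn x).+1 => //=.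
  by rewrite in_itv/= truncnS_gt.
- by move=> _ [r ->]; exact: Xlt.
- move=> k; apply: le_lt_trans (ltry 1); exact: probability_le1.
Qed.

(** The boolean [i] allows a closed or an open left end, for [[0, 1]] and for the second branch
    interval []1 - w, 1]] of [Tmap]. *)
Lemma lebesgue_measure_itv_lt (i : bool) (a b r : R) : a <= b ->
  mu ([set` Interval (BSide i a) (BRight b)] `&` `]-oo, r[%classic) =
  (Num.max 0 (Num.min b r - a))%:E.
Proof.
move=> ab; have [br|rb] := ltP b r.
  rewrite setIidl; last first.
    move=> x /=; rewrite !in_itv/= => /andP[_ xb]; exact: le_lt_trans br.
  rewrite lebesgue_measure_itv/= lte_fin max_r ?subr_ge0//.
  by case: ltP => // ba; have/le_anti -> : a <= b <= a; rewrite ?ab ?ba ?subrr.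
have -> : [set` Interval (BSide i a) (BRight b)] `&` `]-oo, r[%classic =
    [set` Interval (BSide i a) (BLeft r)].
  apply/seteqP; split=> x /=; rewrite !in_itv/=.
    by move=> [/andP[-> _] ->].
  by move=> /andP[-> xr]; rewrite xr (ltW (lt_le_trans xr rb)).
rewrite lebesgue_measure_itv/= lte_fin.
by case: ltP => ar; [rewrite max_r// subr_ge0 ltW|rewrite max_l// subr_le0].
Qed.

Lemma lebesgue_measure_itv_gt (a b r : R) : a <= b ->
  mu (`[a, b]%classic `&` `]r, +oo[%classic) =
  (Num.max 0 (b - Num.max a r))%:E.
Proof.
move=> ab; have [ra|ar] := ltP r a.
  rewrite setIidl; last first.
    move=> x /=; rewrite !in_itv/= andbT => /andP[ax _]; exact: lt_le_trans ax.
  rewrite lebesgue_measure_itv/= lte_fin max_r ?subr_ge0//.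
  by case: ltP => // ba; have/le_anti -> : a <= b <= a; rewrite ?ab ?ba ?subrr.
have -> : `[a, b]%classic `&` `]r, +oo[%classic = `]r, b]%classic.
  apply/seteqP; split=> x /=; rewrite !in_itv/= andbT.
    by move=> [/andP[_ ->] ->].
  by move=> /andP[rx ->]; rewrite rx (le_trans ar (ltW rx)).
rewrite lebesgue_measure_itv/= lte_fin.
by case: ltP => rb; [rewrite max_r// subr_ge0 ltW|rewrite max_l// subr_le0].
Qed.

Lemma measurable_onem : measurable_fun setT (fun x : RT => 1 - x : R).
Proof. by apply: measurable_funB => //; exact: measurable_cst. Qed.

Lemma measurable_Tmap (w : R) : measurable_fun setT (Tmap w : RT -> R).
Proof.
rewrite /Tmap; apply: measurable_fun_ifT.
- by apply: measurable_fun_ler => //; exact: measurable_cst.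
- exact: measurable_onem.
- apply: measurable_funB; last exact: measurable_cst.
  by apply: measurable_funD => //; exact: measurable_cst.
Qed.

Lemma uniform_law_onem : uniform_law (unif01 R) (fun x => 1 - x).
Proof.
apply: lt_uniform_law; first exact: measurable_onem.
move=> r; rewrite !unif01E//; last first.
  by rewrite -[_ @^-1` _]setTI; exact: measurable_onem.
rewrite [in RHS]setIC lebesgue_measure_itv_lt//.
have -> : (fun x : R => 1 - x) @^-1` `]-oo, r[%classic = `]1 - r, +oo[%classic.
  by apply/seteqP; split=> x /=; rewrite !in_itv/= andbT; lra.
rewrite setIC lebesgue_measure_itv_gt//; congr (_%:E).
by rewrite /Num.max /Num.min; do ! case: ifPn; rewrite -?leNgt; lra.
Qed.

(** The branches are isometries onto [[w, 1]] and []0, w]], which tile the unit interval up to null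
    sets; the lengths of the preimages of a ray therefore add up. *)
Lemma uniform_law_Tmap (w : R) : 0 <= w <= 1 ->
  uniform_law (unif01 R) (Tmap w).
Proof.
move=> /andP[w0 w1]; apply: lt_uniform_law; first exact: measurable_Tmap.
move=> r; rewrite !unif01E//; last first.
  by rewrite -[_ @^-1` _]setTI; exact: measurable_Tmap.
rewrite [in RHS]setIC lebesgue_measure_itv_lt//.
have -> : Tmap w @^-1` `]-oo, r[%classic `&` `[0, 1]%classic =
    (`[0, 1 - w]%classic `&` `]1 - r, +oo[%classic) `|`
    (`]1 - w, 1]%classic `&` `]-oo, r + 1 - w[%classic).
  apply/seteqP; split=> x /=; rewrite /Tmap !in_itv/= andbT.
    by case: (leP x (1 - w)) => xw [xr /andP[x0 x1]]; [left|right]; split; lra.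
  by case=> -[/andP[x0 x1] xr]; case: (leP x (1 - w)) => xw; split; lra.
set A := _ `&` `]1 - r, +oo[%classic;
  set B := _ `&` `]-oo, _[%classic.
have -> : mu (A `|` B) = (mu A + mu B)%E.
  apply: measureU; [exact: measurableI|exact: measurableI|].
  rewrite -subset0 => x [[/= + _] [/= + _]].
  by rewrite !in_itv/= => ? ?; exfalso; lra.
rewrite /A /B lebesgue_measure_itv_gt ?lebesgue_measure_itv_lt; [|lra..].
rewrite -EFinD; congr (_%:E).
by rewrite /Num.max /Num.min; do ! case: ifPn; rewrite -?leNgt; lra.
Qed.

Lemma uniform_law_comp d (T : measurableType d) (P : probability T R)
    (X : T -> R) (h : R -> R) : measurable_fun (setT : set RT) h ->
  uniform_law P X -> uniform_law (unif01 R) h -> uniform_law P (h \o X).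
Proof.
move=> mh PX uh A mA; rewrite comp_preimage PX ?uh//.
by rewrite -[_ @^-1` _]setTI; exact: mh.
Qed.

(** This change of variables makes the integrals of the potentials independent of the coupling. *)
Lemma Rintegral_uniform_law d (T : measurableType d) (P : probability T R)
    (X : T -> R) (g : R -> R) (M : R) :
  measurable_fun setT X -> measurable_fun setT g ->
  (forall x, `|g x| <= M) -> uniform_law P X ->
  \int[P]_t g (X t) = \int[unif01 R]_x g x.
Proof.
move=> mX mg gM PX; rewrite /Rintegral; congr fine.
rewrite -[LHS](@integral_pushforward _ _ T RT R X mX P setT (EFin \o g)) //.
- by apply: eq_measure_integral => A mA _; exact: PX.
- exact/measurable_EFinP.
- rewrite preimage_setT; apply: bounded_integrable => [|t]; last exact: gM.
  exact: measurableT_comp.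
Qed.

End uniform_law.

(** * Couplings of uniform laws and their duality gap *)

Section coupling.
Context d (T : measurableType d) (R : realType) (P : probability T R).
Local Notation RT := (measurableTypeR R).
Implicit Types X Y : T -> R.

Lemma transpose_joint_cdf X Y :
  transpose (joint_cdf P X Y) = joint_cdf P Y X.
Proof.
apply/funext => u; apply/funext => v; rewrite /transpose /joint_cdf.
by congr (fine (P _)); apply/seteqP; split=> t [].
Qed.

Lemma eq_ae_probability (A B : set T) : measurable A -> measurable B ->
  (\forall t \ae P, A t <-> B t) -> P A = P B.
Proof.
move=> mA mB AB; rewrite -[A]setIT -[B]setIT -!integral_indic//.
apply: ae_eq_integral => //.
- exact/measurable_EFinP/measurable_indic.
- exact/measurable_EFinP/measurable_indic.
- apply: filterS AB => t AB _; rewrite !indicE.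
  have -> // : (t \in A) = (t \in B).
  by apply/idP/idP => /set_mem /AB /mem_set.
Qed.

Lemma ae_uniform_law X (A : set RT) : measurable_fun setT X ->
  uniform_law P X -> measurable A -> unif01 R A = 0%E ->
  \forall t \ae P, ~ A (X t).
Proof.
move=> mX PX mA A0; exists (X @^-1` A); split.
- by rewrite -[_ @^-1` _]setTI; exact: mX.
- by rewrite /= PX.
- by move=> t /= /contrapT.
Qed.

Lemma ae_uniform01 X : measurable_fun setT X -> uniform_law P X ->
  \forall t \ae P, 0 <= X t <= 1.
Proof.
move=> mX PX; have : \forall t \ae P, ~ (~` `[0, 1]%classic : set RT) (X t).
  apply: ae_uniform_law => //; first exact: measurableC.
  by rewrite unif01E ?setICl ?measure0//; exact: measurableC.
by apply: filterS => t /contrapT /=; rewrite in_itv.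
Qed.

Lemma ae_uniform_neq X (a : R) : measurable_fun setT X -> uniform_law P X ->
  \forall t \ae P, X t != a.
Proof.
move=> mX PX; have : \forall t \ae P, ~ ([set a] : set RT) (X t).
  apply: ae_uniform_law => //.
  rewrite unif01E//.
  apply: (subset_measure0 _ _ _ (lebesgue_measure_set1 a)) => //.
  exact: measurableI.
by apply: filterS => t /= Xa; exact/eqP.
Qed.

(** The witness is the law of the pair; it charges only the unit square because both coordinates lie
    in [[0, 1]] almost surely. *)
Lemma copula_joint_cdf X Y : measurable_fun setT X -> measurable_fun setT Y ->
  uniform_law P X -> uniform_law P Y -> is_copula (joint_cdf P X Y).
Proof.
move=> mX mY PX PY.
have mXY : measurable_fun setT (fun t => (X t, Y t) : RT * RT).
  exact: measurable_fun_pair.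
exists (@law _ _ _ T (RT * RT)%type P _ mXY); split => //.
rewrite -(probability_setT P); apply: eq_ae_probability => //.
    by rewrite -[_ @^-1` _]setTI; apply: mXY => //; exact: measurableX.
  apply: filterS2 (ae_uniform01 mX PX) (ae_uniform01 mY PY) => t Xt Yt.
  by split => // _; rewrite /= !in_itv.
Qed.

(** [X] and [Y] are the variables whose joint distribution function is the copula, so the potentials
    are evaluated at their reflections. Clipping makes the surplus nonnegative at every point. *)
Definition surplus X Y t :=
  potx (1 - clip (X t)) + poty (1 - clip (Y t)) -
  cost (1 - clip (X t)) (1 - clip (Y t)).

Lemma onem_clip01 (s : R) : 0 <= 1 - clip s <= 1.
Proof. by have /andP[c0 c1] := clip01 s; apply/andP; split; lra. Qed.

Lemma surplus_ge0 X Y t : 0 <= surplus X Y t.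
Proof. by rewrite subr_ge0 cost_le_pot// onem_clip01. Qed.

Lemma measurable_onem_clip : measurable_fun setT (fun s : R => 1 - clip s).
Proof.
apply: measurable_funB; first exact: measurable_cst.
exact: measurable_clip.
Qed.

Lemma measurable_potx : measurable_fun setT (@potx R).
Proof.
rewrite /potx; apply: measurable_fun_ifT.
- by apply: measurable_fun_ler => //; exact: measurable_cst.
- apply: measurable_funB; first exact: measurable_cst.
  apply: measurable_funM => //; apply: measurable_funX.
  by apply: measurable_funB => //; exact: measurable_cst.
- apply: measurable_funD; last exact: measurable_cst.
  apply: measurable_funB; exact: measurable_funM.
Qed.

Lemma measurable_poty : measurable_fun setT (@poty R).
Proof.
rewrite /poty; apply: measurable_fun_ifT.
- by apply: measurable_fun_ler => //; exact: measurable_cst.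
- apply: measurable_funB; exact: measurable_funM.
- apply: measurable_funB; last exact: measurable_cst.
  apply: measurable_funM => //; apply: measurable_funX.
  by apply: measurable_funB => //; exact: measurable_cst.
Qed.

Lemma potx_le1 (x : R) : 0 <= x <= 1 -> `|potx x| <= 1.
Proof.
by move=> /andP[x0 x1]; rewrite ler_norml /potx; case: ifP => _; nra.
Qed.

Lemma poty_le1 (y : R) : 0 <= y <= 1 -> `|poty y| <= 1.
Proof.
by move=> /andP[y0 y1]; rewrite ler_norml /poty; case: ifP => _; nra.
Qed.

Lemma cost_le1 (x y : R) : 0 <= x <= 1 -> 0 <= y <= 1 -> `|cost x y| <= 1.
Proof.
move=> /andP[x0 x1] /andP[y0 y1]; rewrite /cost normrM.
apply: mulr_ile1 => //; first by rewrite ger0_norm ?mulr_ge0// mulr_ile1.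
by rewrite ler_norml; lra.
Qed.


(** The dual value, written under [unif01] so that no coupling enters it. *)
Definition duality_bound : R :=
  \int[unif01 R]_s potx (1 - clip s) + \int[unif01 R]_s poty (1 - clip s).

Section integrals.
Variables X Y : T -> R.
Hypotheses (mX : measurable_fun setT X) (mY : measurable_fun setT Y).

Let mqX : measurable_fun setT (fun t => 1 - clip (X t)).
Proof. exact: measurableT_comp measurable_onem_clip mX. Qed.

Let mqY : measurable_fun setT (fun t => 1 - clip (Y t)).
Proof. exact: measurableT_comp measurable_onem_clip mY. Qed.

Let integrable_potx : P.-integrable setT
  (EFin \o (fun t => potx (1 - clip (X t)))).
Proof.
apply: (@bounded_integrable _ _ _ _ _ 1) => [|t].
  exact: measurableT_comp measurable_potx mqX.
exact/potx_le1/onem_clip01.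
Qed.

Let integrable_poty : P.-integrable setT
  (EFin \o (fun t => poty (1 - clip (Y t)))).
Proof.
apply: (@bounded_integrable _ _ _ _ _ 1) => [|t].
  exact: measurableT_comp measurable_poty mqY.
exact/poty_le1/onem_clip01.
Qed.

Let integrable_cost : P.-integrable setT
  (EFin \o (fun t => cost (1 - clip (X t)) (1 - clip (Y t)))).
Proof.
apply: (@bounded_integrable _ _ _ _ _ 1) => [|t].
  apply: measurable_funM; last exact: measurable_funB.
  exact: measurable_funM.
by apply: cost_le1; exact: onem_clip01.
Qed.

Let integrable_pot : P.-integrable setT
  (EFin \o (fun t => potx (1 - clip (X t)) + poty (1 - clip (Y t)))).
Proof. exact: (integrableD measurableT integrable_potx integrable_poty). Qed.

Lemma integrable_surplus : P.-integrable setT (EFin \o surplus X Y).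
Proof. exact: (integrableB measurableT integrable_pot integrable_cost). Qed.

Lemma blest_diff_cost :
  blest (joint_cdf P X Y) - blest (transpose (joint_cdf P X Y)) =
  12 * \int[P]_t cost (1 - clip (X t)) (1 - clip (Y t)).
Proof.
rewrite transpose_joint_cdf !blest_joint_cdf//.
have int2 (f g : T -> R) : measurable_fun setT f -> measurable_fun setT g ->
    (forall t, 0 <= f t <= 1) -> (forall t, 0 <= g t <= 1) ->
    P.-integrable setT (EFin \o (fun t => f t ^+ 2 * g t)).
  move=> mf mg f01 g01; apply: (@bounded_integrable _ _ _ _ _ 1) => [|t].
    by apply: measurable_funM => //; exact: measurable_funX.
  have /andP[f0 f1] := f01 t; have /andP[g0 g1] := g01 t.
  by rewrite ger0_norm ?mulr_ge0 ?exprn_ge0// mulr_ile1 ?exprn_ge0// exprn_ile1.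
have -> (a b : R) : 12 * a - 2 - (12 * b - 2) = 12 * (a - b) by ring.
rewrite -RintegralB//; [|by apply: int2 => // t; exact: onem_clip01..].
by congr (_ * _); apply: eq_Rintegral => t _; rewrite /cost; ring.
Qed.

(** The mean surplus is the exact duality gap: its sign yields the bound and its vanishing
    characterizes the maximizers. *)
Lemma blest_diff_surplus : uniform_law P X -> uniform_law P Y ->
  blest (joint_cdf P X Y) - blest (transpose (joint_cdf P X Y)) =
  12 * (duality_bound - \int[P]_t surplus X Y t).
Proof.
move=> PX PY; rewrite blest_diff_cost; congr (_ * _).
rewrite /surplus RintegralB// RintegralD// /duality_bound.
rewrite -(@Rintegral_uniform_law _ _ _ P X (fun s => potx (1 - clip s)) 1)//.
- rewrite -(@Rintegral_uniform_law _ _ _ P Y (fun s => poty (1 - clip s)) 1)//.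
  + by ring.
  + exact: measurableT_comp measurable_poty measurable_onem_clip.
  + by move=> s; exact/poty_le1/onem_clip01.
- exact: measurableT_comp measurable_potx measurable_onem_clip.
- by move=> s; exact/potx_le1/onem_clip01.
Qed.

End integrals.

End coupling.

(** * The coefficients of the extremal copula and the value of the bound *)

Section extremal_copula.
Variable R : realType.
Local Notation RT := (measurableTypeR R).
Local Notation T34 := (@Tmap R (3 / 4)).
Local Notation A34 := (@Acopula R (3 / 4)).

(** Along the graph of [Tmap] the integrands are polynomial on each side of one breakpoint; [p] and
    [q] are antiderivatives of the two pieces. *)
Lemma Rintegral_unif01 (f : R -> R) (p q : {poly R}) (a : R) : 0 <= a <= 1 ->
  measurable_fun (setT : set RT) f -> (forall x, 0 <= f x) ->
  (forall x, 0 <= x <= a -> f x = p^`().[x]) ->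
  (forall x, a < x <= 1 -> f x = q^`().[x]) ->
  \int[unif01 R]_x f x = p.[a] - p.[0] + (q.[1] - q.[a]).
Proof.
move=> /andP[a0 a1] mf f0 fp fq.
have mEf : measurable_fun (setT : set RT) (EFin \o f) by exact/measurable_EFinP.
rewrite /Rintegral integral_uniform//.
rewrite subr0 invr1 mul1e.
have mq : measurable_fun (setT : set RT) (horner q^`()).
  by apply: continuous_measurable_fun; exact: continuous_horner.
have -> : `[0, 1]%classic = `[0, a]%classic `|` `]a, 1]%classic :> set R.
  by rewrite -itv_bndbnd_setU ?bnd_simp.
rewrite ge0_integral_setU//=.
- rewrite (eq_integral (fun x : RT => (p^`().[x])%:E)); last first.
    by move=> x; rewrite inE/= in_itv/= => /fp ->.
  rewrite [X in (_ + X)%E](eq_integral (fun x : RT => (q^`().[x])%:E));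
    last first.
    by move=> x; rewrite inE/= in_itv/= => /fq ->.
  rewrite integral_itv_obnd_cbnd; last first.
    exact/measurable_EFinP/measurable_funTS.
  by rewrite !integral_deriv_poly.
- exact: measurable_funTS.
- by move=> x _; rewrite lee_fin.
- rewrite disj_set2E; apply/eqP; rewrite -subset0 => x [].
  by rewrite /= !in_itv/= => /andP[_ xa] /andP[]; rewrite ltNge xa.
Qed.

Lemma measurable_onem_Tmap : measurable_fun setT (fun x : RT => 1 - T34 x : R).
Proof. exact: measurableT_comp (@measurable_onem R) (measurable_Tmap _). Qed.

Lemma uniform_law_onem_Tmap : uniform_law (unif01 R) (fun x => 1 - T34 x).
Proof.
have T_unif : uniform_law (unif01 R) T34 by apply: uniform_law_Tmap; lra.
exact: (uniform_law_comp (@measurable_onem R) T_unif (@uniform_law_onem R)).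
Qed.

Lemma copula_Acopula : is_copula A34.
Proof.
apply: copula_joint_cdf.
- exact: measurable_onem.
- exact: measurable_onem_Tmap.
- exact: uniform_law_onem.
- exact: uniform_law_onem_Tmap.
Qed.

Lemma onem_clip_onem (x : R) : 0 <= x <= 1 -> 1 - clip (1 - x) = x.
Proof. by move=> x01; rewrite clip_id; [ring|lra]. Qed.

Let sq_mul_ge0 (a b : R) : 0 <= (1 - clip a) ^+ 2 * (1 - clip b).
Proof. by rewrite mulr_ge0 ?sqr_ge0//; have /andP[] := onem_clip01 b. Qed.

Let measurable_sq_mul (f g : R -> R) :
  measurable_fun (setT : set RT) f -> measurable_fun (setT : set RT) g ->
  measurable_fun (setT : set RT)
    (fun x => (1 - clip (f x)) ^+ 2 * (1 - clip (g x)) : R).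
Proof.
move=> mf mg; apply: measurable_funM; first apply: measurable_funX.
  exact: measurableT_comp (@measurable_onem_clip R) mf.
exact: measurableT_comp (@measurable_onem_clip R) mg.
Qed.

Lemma Tmap_left x : x <= 1 / 4 -> T34 x = 1 - x.
Proof. by move=> x4; rewrite /Tmap ifT//; lra. Qed.

Lemma Tmap_right x : 1 / 4 < x -> T34 x = x - 1 / 4.
Proof. by move=> x4; rewrite /Tmap ifF; [field|apply/negbTE; lra]. Qed.

Lemma blest_Acopula : blest A34 = 7 / 128.
Proof.
rewrite blest_joint_cdf; [|exact: measurable_onem|exact: measurable_onem_Tmap].
(* Antiderivatives of [x ^+ 2 * (1 - x)] and [x ^+ 2 * (x - 1 / 4)], the two branches of the
   integrand. *)
rewrite (@Rintegral_unif01 _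
  ((1 / 3)%:P * 'X^3 - (1 / 4)%:P * 'X^4)
  ((1 / 4)%:P * 'X^4 - (1 / 12)%:P * 'X^3) (1 / 4)).
- by rewrite !hornerE/=; field.
- lra.
- by apply: measurable_sq_mul;
    [exact: measurable_onem|exact: measurable_onem_Tmap].
- by move=> x; exact: sq_mul_ge0.
- move=> x /andP[x0 x4]; rewrite !onem_clip_onem ?Tmap01//; try lra.
  by rewrite Tmap_left// !poly.derivE !hornerE/=; field.
- move=> x /andP[x0 x4]; rewrite !onem_clip_onem ?Tmap01//; try lra.
  by rewrite Tmap_right// !poly.derivE !hornerE/=; field.
Qed.

Lemma blest_transpose_Acopula : blest (transpose A34) = - (47 / 128).
Proof.
rewrite transpose_joint_cdf.
rewrite blest_joint_cdf; [|exact: measurable_onem_Tmap|exact: measurable_onem].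
(* Antiderivatives of [(1 - x) ^+ 2 * x] and [(x - 1 / 4) ^+ 2 * x]. *)
rewrite (@Rintegral_unif01 _
  ((1 / 2)%:P * 'X^2 - (2 / 3)%:P * 'X^3 + (1 / 4)%:P * 'X^4)
  ((1 / 4)%:P * 'X^4 - (1 / 6)%:P * 'X^3 + (1 / 32)%:P * 'X^2) (1 / 4)).
- by rewrite !hornerE/=; field.
- lra.
- by apply: measurable_sq_mul;
    [exact: measurable_onem_Tmap|exact: measurable_onem].
- by move=> x; exact: sq_mul_ge0.
- move=> x /andP[x0 x4]; rewrite !onem_clip_onem ?Tmap01//; try lra.
  by rewrite Tmap_left// !poly.derivE !hornerE/=; field.
- move=> x /andP[x0 x4]; rewrite !onem_clip_onem ?Tmap01//; try lra.
  by rewrite Tmap_right// !poly.derivE !hornerE/=; field.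
Qed.

Lemma surplus_Acopula x : 0 <= x <= 1 ->
  surplus (fun x : RT => 1 - x) (fun x : RT => 1 - T34 x) x = 0.
Proof.
move=> x01; rewrite /surplus !onem_clip_onem ?Tmap01//.
by rewrite cost_Tmap// subrr.
Qed.

(** The extremal coupling has no surplus, so its coefficients [7 / 128] and [- (47 / 128)] give the
    bound without integrating the potentials. *)
Lemma duality_boundE : duality_bound R = 9 / 256.
Proof.
have := @blest_diff_surplus _ _ _ (unif01 R) (fun x : RT => 1 - x)
  (fun x : RT => 1 - T34 x) (@measurable_onem R) measurable_onem_Tmap
  (@uniform_law_onem R) uniform_law_onem_Tmap.
rewrite blest_Acopula blest_transpose_Acopula.
(* The surplus vanishes on all of [[0, 1]], hence zero polynomials and a trivial breakpoint. *)
rewrite (@Rintegral_unif01 _ 0 0 0).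
- by rewrite !horner0 => ?; lra.
- by rewrite lexx ler01.
- apply/measurable_EFinP; apply: (measurable_int (unif01 R)).
  exact: integrable_surplus (@measurable_onem R) measurable_onem_Tmap.
- by move=> x; exact: surplus_ge0.
- move=> x /andP[x0 x1]; rewrite surplus_Acopula ?deriv0 ?horner0//; lra.
- move=> x /andP[x0 x1]; rewrite surplus_Acopula ?deriv0 ?horner0//; lra.
Qed.

End extremal_copula.

(** * The upper bound for couplings and uniqueness of the maximizer *)

Section extremality.
Context d (T : measurableType d) (R : realType) (P : probability T R).
Variables X Y : T -> R.
Hypotheses (mX : measurable_fun setT X) (mY : measurable_fun setT Y).
Hypotheses (PX : uniform_law P X) (PY : uniform_law P Y).
Local Notation RT := (measurableTypeR R).
Local Notation J := (joint_cdf P X Y).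

Lemma blest_diff_le : blest J - blest (transpose J) <= 27 / 64.
Proof.
rewrite blest_diff_surplus// duality_boundE.
have : 0 <= \int[P]_t surplus X Y t.
  by apply: Rintegral_ge0 => t _; exact: surplus_ge0.
lra.
Qed.

Lemma blest_diff_eq : blest J - blest (transpose J) = 27 / 64 ->
  J = Acopula (3 / 4).
Proof.
rewrite blest_diff_surplus// duality_boundE => eqJ.
have surplus0 : \int[P]_t surplus X Y t = 0 by lra.
have isur := integrable_surplus P mX mY.
(* A nonnegative function of integral 0 vanishes almost surely; integrability excludes an infinite
   integral sent to 0 by [fine]. *)
have : ae_eq P setT (EFin \o surplus X Y) (cst 0%E).
  apply/ae_eq_integral_abs => //; first exact: measurable_int isur.
  rewrite (eq_integral (EFin \o surplus X Y)); last first.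
    by move=> t _; rewrite gee0_abs// lee_fin surplus_ge0.
  rewrite -[LHS]fineK; last exact: integrable_fin_num.
  by rewrite -[fine _]/(\int[P]_t surplus X Y t) surplus0.
(* [h] is [Tmap (3 / 4)] conjugated by the reflection that relates copula variables to transport
   variables. *)
pose h (s : R) := 1 - Tmap (3 / 4) (1 - s).
have mh : measurable_fun (setT : set RT) h.
  exact: measurableT_comp (@measurable_onem_Tmap R) (@measurable_onem R).
move=> sur0.
(* The null event [X t = 3 / 4] is discarded: it is the abscissa [1 / 4] at which equality does not
   force the graph. *)
have YhX : \forall t \ae P, Y t = h (X t).
  apply: filterS3 (filterI sur0 (ae_uniform01 mX PX)) (ae_uniform01 mY PY)
    (ae_uniform_neq (3 / 4) mX PX) => t [/(_ I) [] surXY X01] Y01 XN.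
  have e : 1 - Y t = Tmap (3 / 4) (1 - X t).
    apply: cost_eq_pot; [lra|lra|lra|].
    move: surXY; rewrite /surplus !clip_id//; lra.
  by rewrite /h -e; ring.
apply/funext => u; apply/funext => v; rewrite /Acopula /joint_cdf; congr fine.
(* Both distribution functions at [(u, v)] are the probability that a uniform variable falls in [S]:
   [X] under [P], and [1 - x] under [unif01]. *)
pose S : set RT := [set s | s <= u /\ h s <= v].
have mS : measurable S.
  rewrite (_ : S = (setT `&` [set s : RT | id s <= cst u s]) `&`
    (setT `&` [set s : RT | h s <= cst v s])); last by rewrite !setTI.
  by apply: measurableI; apply: measurable_fun_le.
have -> : [set x : R | 1 - x <= u /\ 1 - Tmap (3 / 4) x <= v] =
    (fun x => 1 - x) @^-1` S.
  apply/seteqP; split => x /=; rewrite /S /h /=.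
    by rewrite (_ : 1 - (1 - x) = x)//; ring.
  by rewrite (_ : 1 - (1 - x) = x)//; ring.
rewrite (uniform_law_onem mS) -PX//.
apply: eq_ae_probability.
- rewrite (_ : [set t | _] = (setT `&` [set t | X t <= cst u t]) `&`
    (setT `&` [set t | Y t <= cst v t])); last by rewrite !setTI.
  by apply: measurableI; apply: measurable_fun_le.
- by rewrite -[_ @^-1` _]setTI; exact: mX.
- by apply: filterS YhX => t Yt; rewrite /S/= Yt.
Qed.

End extremality.

(** * Transfer from couplings to representatives of copulas *)

Section copulas.
Variable R : realType.
Implicit Types C D : R -> R -> R.

Lemma eq_on_square_transpose C D :
  eq_on_square C D -> eq_on_square (transpose C) (transpose D).
Proof. by move=> CD u v u01 v01; exact: CD. Qed.

Lemma eq_on_square_trans C D E :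
  eq_on_square C D -> eq_on_square D E -> eq_on_square C E.
Proof. by move=> CD DE u v u01 v01; rewrite CD// DE. Qed.

Lemma eq_blest C D : eq_on_square C D -> blest C = blest D.
Proof.
move=> CD; rewrite /blest; congr (24 * _ - 2).
apply: eq_Rintegral => v /set_mem/=; rewrite in_itv/= => v01.
apply: eq_Rintegral => u /set_mem/=; rewrite in_itv/= => u01.
by rewrite CD.
Qed.

Lemma eq_copula C D : eq_on_square C D -> is_copula D -> is_copula C.
Proof.
move=> CD [P [P1 P2 P3 DP]]; exists P; split=> //.
exact: eq_on_square_trans DP.
Qed.

Lemma copula_coupling C : is_copula C ->
  exists P : probability (measurableTypeR R * measurableTypeR R)%type R,
    [/\ uniform_law P (fst : _ -> R), uniform_law P (snd : _ -> R)
      & eq_on_square C (joint_cdf P fst snd)].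
Proof. by move=> [P [_ P1 P2 CP]]; exists P. Qed.

Lemma copula_transpose C : is_copula C -> is_copula (transpose C).
Proof.
move=> /copula_coupling[P [P1 P2 CP]].
apply: eq_copula (eq_on_square_transpose CP) _; rewrite transpose_joint_cdf.
exact: copula_joint_cdf.
Qed.

Lemma copula_blest_diff_le C : is_copula C ->
  blest C - blest (transpose C) <= 27 / 64.
Proof.
move=> /copula_coupling[P [P1 P2 CP]].
rewrite (eq_blest CP) (eq_blest (eq_on_square_transpose CP)).
exact: blest_diff_le.
Qed.

Lemma copula_blest_diff_eq C : is_copula C ->
  blest C - blest (transpose C) = 27 / 64 ->
  eq_on_square C (Acopula (3 / 4)).
Proof.
move=> /copula_coupling[P [P1 P2 CP]].
rewrite (eq_blest CP) (eq_blest (eq_on_square_transpose CP)) => e.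
by rewrite -(blest_diff_eq _ _ P1 P2 e).
Qed.

End copulas.

(** * Sharp two-sided bounds and their unique extremal copulas *)

Theorem corollary4p5 (R : realType) :
  (forall C : R -> R -> R, is_copula C ->
     [/\ `|blest C - sym_blest C| <= 27 / 128,
         `|blest C - blest (transpose C)| <= 27 / 64
       & `|blest C - sym_blest C| <= 27 / 128 <->
         `|blest C - blest (transpose C)| <= 27 / 64]) /\
  (let A : R -> R -> R := Acopula (3 / 4) in
   [/\ is_copula A,
       sym_blest A = - (5 / 32) /\ blest A = 7 / 128,
       blest A - sym_blest A = 27 / 128 /\
       `|blest A - blest (transpose A)| = 27 / 64
     & forall C : R -> R -> R, is_copula C ->
         blest C - sym_blest C = 27 / 128 -> eq_on_square C A]) /\
  (let B : R -> R -> R := transpose (Acopula (3 / 4)) in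
   [/\ is_copula B,
       blest B - sym_blest B = - (27 / 128)
     & forall C : R -> R -> R, is_copula C ->
         blest C - sym_blest C = - (27 / 128) -> eq_on_square C B]).
Proof.
have diff_le (C : R -> R -> R) : is_copula C ->
    `|blest C - blest (transpose C)| <= 27 / 64.
  (* The lower bound is the upper bound for the transpose, transposition being a definitional
     involution. *)
  move=> cC; rewrite ler_norml.
  have := copula_blest_diff_le cC.
  have := copula_blest_diff_le (copula_transpose cC).
  rewrite -[transpose (transpose C)]/C.
  by move: (blest C) (blest (transpose C)) => a b; lra.
have swap (a b : R) : (a - b) / 2 = - (27 / 128) -> (b - a) / 2 = 27 / 128.
  by lra.
have symE (C : R -> R -> R) :
    blest C - sym_blest C = (blest C - blest (transpose C)) / 2.
  rewrite /sym_blest.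
  by move: (blest C) (blest (transpose C)) => a b; field.
have sym_le (C : R -> R -> R) : is_copula C ->
    `|blest C - sym_blest C| <= 27 / 128.
  move=> /diff_le; rewrite symE !ler_norml.
  by move: (blest C - _) => a; lra.
have cA : is_copula (@Acopula R (3 / 4)) by exact: copula_Acopula.
have uniqA (C : R -> R -> R) : is_copula C ->
    blest C - sym_blest C = 27 / 128 -> eq_on_square C (Acopula (3 / 4)).
  have half (a : R) : a / 2 = 27 / 128 -> a = 27 / 64 by lra.
  by move=> cC; rewrite symE => /half; exact: copula_blest_diff_eq.
have bA := blest_Acopula R; have bAt := blest_transpose_Acopula R.
split; [|split] => /=.
- move=> C cC; split; [exact: sym_le|exact: diff_le|].
  by split=> _; [exact: diff_le|exact: sym_le].
- split=> //.
  + by rewrite /sym_blest bA bAt; split; field.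
  + rewrite symE bA bAt; split; first by field.
    by rewrite ger0_norm; [field|clear; lra].
- split; first exact: copula_transpose.
  + by rewrite symE -[transpose (transpose _)]/(Acopula _) bA bAt; field.
  (* Transposition changes the sign of the difference, so the transpose of a minimizer is a
     maximizer. *)
  + move=> C cC e; apply: (@eq_on_square_transpose _ (transpose C)).
    apply: uniqA; first exact: copula_transpose.
    rewrite symE; apply: swap.
    by rewrite -[transpose (transpose C)]/C -(symE C).
Qed.
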